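(* For a metric space $X$, the following conditions are equivalent: (1) $X$ is a Lipschitz image of a totally bounded injective metric space; (2) $X$ is a Lipschitz image of a compact $\mathbb{R}$-tree; (3) $X$ is compact, Lipschitz connected, and its intrinsic metric $d_{IX}$ is totally bounded.
   Context: The metric of a metric space $X$ is denoted $d_X$. For a map $f:X\to Y$ between metric spaces, $\operatorname{Lip}(f):=\sup_{x\ne x'}\frac{d_Y(f(x),f(x'))}{d_X(x,x')}\in[0,\infty]$ (with $\sup\varnothing=0$). The map $f$ is Lipschitz if $\operatorname{Lip}(f)<\infty$, and $L$-Lipschitz (for a real number $L$) if $\operatorname{Lip}(f)\le L$. A metric space $Y$ is a Lipschitz image of a metric space $X$ if there exists a surjective Lipschitz map $X\to Y$. A metric space $X$ is injective if every $1$-Lipschitz map $f:B\to X$ defined on a subspace $B$ of a metric space $A$ extends to a $1$-Lipschitz map $\bar f:A\to X$. For points $x,y$ of a metric space $X$, the metric segment is $[x,y]:=\{z\in X:d_X(x,y)=d_X(x,z)+d_X(z,y)\}$. A metric space $X$ is an $\mathbb{R}$-tree if for all $x,y\in X$ the metric segment $[x,y]$ is isometric to the interval $[0,d_X(x,y)]$ of the real line, and for all $x,y,z\in X$ with $[x,y]\cap[y,z]=\{y\}$ we have $d_X(x,z)=d_X(x,y)+d_X(y,z)$. A metric space $X$ is Lipschitz connected if for all points $x,y\in X$ there exists a Lipschitz map $f:[0,1]\to X$ with $f(0)=x$ and $f(1)=y$. Every Lipschitz connected metric space $X$ carries the intrinsic metric $d_{IX}(x,y):=\inf\{\operatorname{Lip}(f):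 f:[0,1]\to X,\ f(0)=x,\ f(1)=y\}$. A metric $d$ on a set $X$ is called totally bounded if the metric space $(X,d)$ is totally bounded.
   Formalization: The metric space X is assumed nonempty: the empty space satisfies (2) and (3) but not (1), because every injective metric space is nonempty and so has no map to the empty space. *)

(* Defs.v *)
From HB Require Import structures.
From mathcomp Require Import all_boot all_order all_algebra.
From mathcomp Require Import all_classical all_reals all_analysis.

Set Implicit Arguments.
Unset Strict Implicit.
Unset Printing Implicit Defensive.

Import Order.TTheory GRing.Theory Num.Theory.

Local Open Scope classical_set_scope.
Local Open Scope ring_scope.

(* The sigma type of a subset only comes with the induced pseudometric. *)
Section SubspaceMetric.
Context {R : realType} {X : metricType R} (A : set X).

Let dist (x y : A) : R := mdist (\val x) (\val y).

Let dist_ge0 x y : 0 <= dist x y. Proof. exact: mdist_ge0. Qed.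

Let dist_positivity x y : dist x y = 0 -> x = y.
Proof. by move=> xy; apply/val_inj/mdist_positivity. Qed.

Let ballEdist (x : A) d : ball x d = [set y | dist x y < d].
Proof. by rewrite /ball /= /initial_ball ballEmdist. Qed.

HB.instance Definition _ := @PseudoMetric_isMetric.Build R A
  dist dist_ge0 dist_positivity ballEdist.

End SubspaceMetric.

Section Definitions.
Context {R : realType}.
Implicit Types X Y T : metricType R.

(* [ereal_sup set0] is [-oo]; the [maxe] encodes the convention sup set0 = 0,
   the supremum being taken in [0, +oo]. *)
Definition Lip X Y (f : X -> Y) : \bar R :=
  maxe 0%E (ereal_sup
    [set (mdist (f p.1) (f p.2) / mdist p.1 p.2)%:E |
      p in [set p : X * X | p.1 <> p.2]]).

Definition lipschitz_map X Y (f : X -> Y) : Prop := (Lip f < +oo)%E.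

Definition klipschitz_map (L : R) X Y (f : X -> Y) : Prop := (Lip f <= L%:E)%E.

(* [lipschitz_image X Y]: Y is a Lipschitz image of X. *)
Definition lipschitz_image X Y : Prop :=
  exists2 f : X -> Y, set_surj setT setT f & lipschitz_map f.

Definition injective_space X : Prop :=
  forall (A : metricType R) (B : set A) (f : B -> X), klipschitz_map 1 f ->
    exists2 g : A -> X, klipschitz_map 1 g & forall b : B, g (\val b) = f b.

Definition isometric X Y : Prop :=
  exists2 f : X -> Y, set_surj setT setT f &
    forall x x', mdist (f x) (f x') = mdist x x'.

Definition segment X (x y : X) : set X :=
  [set z | mdist x y = mdist x z + mdist z y].

(* The metric structure on R with distance |y - x| is attached to [R^o]. *)
Definition line_segment (a b : R) : set R^o := `[a, b].

Definition Rtree X : Prop :=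
  (forall x y : X, isometric (segment x y) (line_segment 0 (mdist x y))) /\
  (forall x y z : X, segment x y `&` segment y z = [set y] ->
    mdist x z = mdist x y + mdist y z).

Definition unit_interval : set R^o := line_segment 0 1.

Lemma unit_interval0 : 0 \in unit_interval.
Proof. by rewrite inE /unit_interval /line_segment /= in_itv /= lexx ler01. Qed.

Lemma unit_interval1 : 1 \in unit_interval.
Proof. by rewrite inE /unit_interval /line_segment /= in_itv /= lexx ler01. Qed.

Definition joins X (x y : X) (f : unit_interval -> X) : Prop :=
  f (exist _ 0 unit_interval0) = x /\ f (exist _ 1 unit_interval1) = y.

Definition lipschitz_connected X : Prop :=
  forall x y : X, exists2 f, joins x y f & lipschitz_map f.

(* The infimum is finite as soon as some Lipschitz path joins x to y, so [fine]
   loses nothing on Lipschitz connected spaces. *)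
Definition intrinsic_dist X (x y : X) : R :=
  fine (ereal_inf [set Lip f | f in joins x y]).

Definition totally_bounded_dist (T : Type) (d : T -> T -> R) : Prop :=
  forall e : R, 0 < e ->
    exists2 F : set T, finite_set F & forall x, exists2 y, F y & d y x < e.

Definition totally_bounded X : Prop := totally_bounded_dist (@mdist R X).

End Definitions.

(* Main.v *)
(* Injective spaces and R-trees are geodesic, and a totally bounded injective
   space is compact: an ultrafilter F yields the Katetov function
   y |-> inf {r | ball y r in F}, and extending the identity to the
   corresponding one-point extension produces a limit of F. A Lipschitz image of
   a compact geodesic space inherits compactness, Lipschitz connectedness and
   total boundedness of the intrinsic metric.

   Conversely, choose finite 2^-(n+1)-nets of X for the intrinsic metric, and
   the rooted tree in which every vertex of level n has one edge of length
   2^-(n+1) for each point of the n-th net. Its completion is totally bounded,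
   injective, and satisfies the four-point condition, so it is a compact R-tree.
   Sending an edge to a Lipschitz path towards the chosen net point whenever that
   point is close enough, and to a constant path otherwise, gives a Lipschitz map
   to X whose image is compact and contains all the nets. *)
Require Import Defs.
From HB Require Import structures.
From mathcomp Require Import all_boot all_order all_algebra.
From mathcomp Require Import all_classical all_reals all_analysis.
From mathcomp Require Import ring lra.

Set Implicit Arguments.
Unset Strict Implicit.
Unset Printing Implicit Defensive.

Import Order.TTheory GRing.Theory Num.Theory.

Local Open Scope classical_set_scope.
Local Open Scope ring_scope.

(** * Lipschitz constants as pointwise inequalities *)

Section Lipschitz.
Context {R : realType}.
Implicit Types X Y Z : metricType R.

Lemma klipschitzP X Y (L : R) (f : X -> Y) : 0 <= L ->
  klipschitz_map L f <-> forall x y, mdist (f x) (f y) <= L * mdist x y.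
Proof.
move=> L0; rewrite /klipschitz_map /Lip ge_max lee_fin L0 /=; split.
- move=> fL x y; have [->|/eqP xy] := eqVneq x y; first by rewrite !mdistxx mulr0.
  have d0 : 0 < mdist x y by rewrite mdist_gt0; apply/eqP.
  rewrite -ler_pdivrMr// -lee_fin; apply: le_trans fL.
  by apply: ereal_sup_ubound; exists (x, y).
- move=> fL; apply: ge_ereal_sup => _ [[x y] /= xy <-].
  have d0 : 0 < mdist x y by rewrite mdist_gt0; apply/eqP.
  by rewrite lee_fin ler_pdivrMr.
Qed.

Lemma Lip_ge0 X Y (f : X -> Y) : (0 <= Lip f)%E.
Proof. by rewrite /Lip le_max lexx. Qed.

Lemma lipschitz_mapP X Y (f : X -> Y) :
  lipschitz_map f <-> exists2 L : R, 0 <= L & klipschitz_map L f.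
Proof.
split=> [|[L _ fL]]; last exact: le_lt_trans fL (ltry _).
rewrite /lipschitz_map /klipschitz_map.
have := Lip_ge0 f; case: (Lip f) => // L L0 _; exists L => //.
Qed.

Lemma klipschitz_comp X Y Z (K L : R) (f : X -> Y) (g : Y -> Z) :
  0 <= K -> 0 <= L -> klipschitz_map K f -> klipschitz_map L g ->
  klipschitz_map (L * K) (g \o f).
Proof.
move=> K0 L0 /klipschitzP-/(_ K0) fK /klipschitzP-/(_ L0) gL.
apply/klipschitzP; first exact: mulr_ge0.
move=> x y /=; rewrite (le_trans (gL _ _))// -mulrA ler_wpM2l//.
Qed.

Lemma klipschitz_continuous X Y (L : R) (f : X -> Y) : 0 <= L ->
  klipschitz_map L f -> continuous f.
Proof.
move=> L0 /klipschitzP-/(_ L0) fL x.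
apply/metricType_numDomainType.cvgrPdist_lt => e e0.
apply/metricType_numDomainType.nbhs_mdistP.
have L1 : 0 < L + 1 by rewrite ltr_wpDl.
exists (e / (L + 1)); first by rewrite /= divr_gt0.
move=> y /=; rewrite ltr_pdivlMr// => xy.
apply: le_lt_trans xy; rewrite (le_trans (fL _ _))// mulrC ler_wpM2l ?mdist_ge0//.
by rewrite lerDl.
Qed.

End Lipschitz.

(** * Katetov functions and one-point extensions *)

Section Katetov.
Context {R : realType} (Y : metricType R).

(* A positive Katetov function is the distance to the new point in a one-point
   metric extension. *)
Record katetov := Katetov {
  katetov_fun :> Y -> R ;
  katetov_gt0 : forall y, 0 < katetov_fun y ;
  katetov_lip : forall x y, katetov_fun x <= katetov_fun y + mdist x y ;
  katetov_tri : forall x y, mdist x y <= katetov_fun x + katetov_fun y }.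

Definition one_point_extension (phi : katetov) : Type := option Y.

Variable phi : katetov.

HB.instance Definition _ := Choice.on (one_point_extension phi).

Let dist (u v : one_point_extension phi) : R :=
  match u, v with
  | Some x, Some y => mdist x y
  | Some x, None | None, Some x => phi x
  | None, None => 0
  end.

Let distxx u : dist u u = 0.
Proof. by case: u => [x|]//=; rewrite mdistxx. Qed.

Let dist_positivity u v : dist u v = 0 -> u = v.
Proof.
case: u v => [x|] [y|] //=; first by move/mdist_positivity ->.
- by move=> p0; have := katetov_gt0 phi x; rewrite p0 ltxx.
- by move=> p0; have := katetov_gt0 phi y; rewrite p0 ltxx.
Qed.

Let dist_sym u v : dist u v = dist v u.
Proof. by case: u v => [x|] [y|] //=; rewrite metric_sym. Qed.

Let dist_triangle v u w : dist u w <= dist u v + dist v w.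
Proof.
case: u v w => [x|] [y|] [z|] //=.
- exact: metric_triangle.
- by rewrite addrC katetov_lip.
- exact: katetov_tri.
- by rewrite addr0.
- by rewrite metric_sym katetov_lip.
- by rewrite addr_ge0// ltW// katetov_gt0.
- by rewrite add0r.
Qed.

HB.instance Definition _ := @isMetric.Build R (one_point_extension phi)
  dist distxx dist_positivity dist_sym dist_triangle.

End Katetov.

(** * Injective spaces: geodesics and compactness *)

Section Injective.
Context {R : realType}.
Implicit Types X Y A : metricType R.

Lemma injective_extend Y A (S : set A) (f : A -> Y) : injective_space Y ->
  {in S &, forall a b, mdist (f a) (f b) <= mdist a b} ->
  exists2 g : A -> Y, forall a b, mdist (g a) (g b) <= mdist a b &
    {in S, g =1 f}.
Proof.
move=> injY fS.
have [|g /klipschitzP-/(_ ler01) g1 gf] := injY A S (f \o \val).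
  apply/klipschitzP => // a b /=; rewrite mul1r.
  by apply: fS; exact: valP.
exists g => [a b|a aS]; first by rewrite -[leRHS]mul1r.
exact: gf (exist _ a aS).
Qed.

Lemma mdist_regE (s t : R^o) : mdist s t = `|t - s|.
Proof. by []. Qed.

(** The Lipschitz bound is the least possible, so such a path has constant speed and is a minimizing
    geodesic. *)
Definition geodesic Y := forall x y : Y,
  exists2 f : @unit_interval R -> Y, joins x y f & klipschitz_map (mdist x y) f.

(** The map 0 |-> x, D |-> y is an isometry on two points of the line; its extension to the whole
    line, rescaled by D, is the path. *)
Lemma injective_geodesic Y : injective_space Y -> geodesic Y.
Proof.
move=> injY x y; set D := mdist x y.
have D0 : 0 <= D by exact: mdist_ge0.
pose f (t : R^o) := if t == 0 then x else y.
have [|g g1 gf] := @injective_extend Y R^o [set 0; D] f injY.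
  move=> a b; rewrite !inE /= /f => aS bS.
  rewrite mdist_regE; case: eqP => [->|a0]; case: eqP => [->|b0]; rewrite ?mdistxx//.
  - by case: bS => // ->; rewrite subr0 ger0_norm.
  - case: aS => // ->; rewrite sub0r normrN ger0_norm// /D metric_sym//.
exists (fun t => g (D * \val t)).
  split=> /=.
    by rewrite mulr0 gf ?inE /=; [rewrite /f eqxx|left].
  rewrite mulr1 gf ?inE /=; last by right.
  (* If D = 0, then [f] takes the value x at D, but x = y in that case. *)
  by rewrite /f; case: eqP => // /mdist_positivity.
apply/klipschitzP => // s t; rewrite (le_trans (g1 _ _))//.
rewrite mdist_regE -mulrBr normrM ger0_norm//.
Qed.

Lemma injective_katetov Y (y0 : Y) (phi : katetov Y) : injective_space Y ->
  exists p, forall y, mdist p y <= phi y.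
Proof.
move=> injY.
pose f (u : one_point_extension phi) := odflt y0 u.
have [|g g1 gf] := @injective_extend Y (one_point_extension phi)
    [set u | exists y, u = Some y] f injY.
  by move=> a b; rewrite !inE => -[x ->] [y ->].
exists (g None) => y.
have gy : g (Some y) = y by rewrite gf// inE; exists y.
by rewrite -{1}gy; exact: (g1 None (Some y)).
Qed.

Lemma injective_totally_bounded_compact Y :
  injective_space Y -> totally_bounded Y -> compact [set: Y].
Proof.
move=> injY tbY; rewrite compact_ultra /= => F UF _.
have FF := @ultra_proper _ _ UF.
(* Otherwise F contains the complements of all balls about a finite e-net, and these have empty
   intersection. *)
have smallF e : 0 < e -> exists y, F (ball y e).
  move=> e0; apply: contrapT => /forallNP nF.
  have [S Sfin Scov] := tbY e e0.
  apply: (@filter_not_empty _ F); have := @filter_bigI _ _ (fset_set S)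
    (fun y => ~` ball y e) F _ => /(_ _) H.
  apply: filterS (H _) => [z zS|y _]; last first.
    by have [/nF|] := in_ultra_setVsetC (ball y e) UF.
  have [y Sy yz] := Scov z; apply: (zS y); last by rewrite ballEmdist.
  by rewrite /= in_fset_set// inE.
pose rad y := [set r : R | 0 < r /\ F (ball y r)].
have radM x y r : rad y r -> rad x (r + mdist x y).
  move=> [r0 Fr]; split; first by rewrite ltr_wpDr// mdist_ge0.
  apply: filterS Fr => z; rewrite !ballEmdist /= => yz.
  by rewrite (le_lt_trans (metric_triangle x y z))// addrC ltrD2r.
have [y0 Fy0] := smallF 1 ltr01.
have rad_inf y : has_inf (rad y).
  split; first by exists (1 + mdist y y0); apply: radM; split.
  by exists 0 => r [/ltW].
pose phi y := inf (rad y).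
have phi_le y r : rad y r -> phi y <= r by exact: (ge_inf (rad_inf y).2).
have phi_lt y r : phi y < r -> exists2 s, rad y s & s < r.
  by move=> /inf_lt - /(_ (rad_inf y).1).
have phi_approx y e : 0 < e -> exists2 s, rad y s & s < phi y + e.
  by move=> e0; apply: phi_lt; rewrite ltrDl.
have phi_ge0 y : 0 <= phi y.
  by apply: lb_le_inf => [|r [/ltW]//]; exact: (rad_inf y).1.
have toF p : (forall e, 0 < e -> F (ball p e)) -> [set: Y] `&` [set p | F --> p] !=set0.
  move=> pF; exists p; split=> // B /nbhs_ballP [e e0 eB].
  exact: filterS eB (pF e e0).
(* A zero of [phi] is itself a limit of F. Without zeros, [phi] is positive, as a one-point
   extension requires. *)
have [[y phiy]|phi_neq0] := pselect (exists y, phi y = 0).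
  apply: (toF y) => e; rewrite -phiy => /phi_lt[s [_ Fs] /ltW se].
  exact: filterS (le_ball se) Fs.
have phi_gt0 y : 0 < phi y.
  by rewrite lt_neqAle phi_ge0 andbT; apply/eqP => p0; apply: phi_neq0; exists y.
have phi_lip x y : phi x <= phi y + mdist x y.
  apply/ler_addgt0Pr => e e0.
  have [s sy se] := phi_approx y _ e0.
  rewrite (le_trans (phi_le _ _ (radM x y s sy)))// addrAC lerD2r ltW//.
have phi_tri x y : mdist x y <= phi x + phi y.
  apply/ler_addgt0Pr => e e0.
  have e2 : 0 < e / 2 by rewrite divr_gt0.
  have [s [_ Fs] sx] := phi_approx x _ e2.
  have [t [_ Ft] ty] := phi_approx y _ e2.
  have [z []] := filter_ex (filterI Fs Ft); rewrite !ballEmdist /= => xz yz.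
  have := metric_triangle x z y; rewrite (metric_sym z y); lra.
have [p pphi] := @injective_katetov Y y0 (Katetov phi_gt0 phi_lip phi_tri) injY.
apply: (toF p) => e e0; have e2 : 0 < e / 2 by rewrite divr_gt0.
(* The centre y of a small ball in F has small [phi y], which bounds its distance to p. *)
have [y Fy] := smallF _ e2.
apply: (filterS _ Fy) => z; rewrite !ballEmdist /= => yz.
have := pphi y; have := phi_le y (e / 2) (conj e2 Fy).
have := metric_triangle p y z => /=; lra.
Qed.

(** Without a finite e-net, the sets of points at distance at least e from a finite set generate a
    proper filter. A cluster point p of it contradicts the member given by the finite set {p}. *)
Lemma compact_totally_bounded Y : compact [set: Y] -> totally_bounded Y.
Proof.
move=> cY e e0; apply: contrapT => nfin.
pose far (S : set Y) := [set x | forall y, S y -> e <= mdist y x].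
have FF : ProperFilter (filter_from finite_set far).
  apply: filter_from_proper => [|S Sfin].
    apply: filter_from_filter; first by exists set0; exact: finite_set0.
    move=> S T Sfin Tfin; exists (S `|` T); first by rewrite finite_setU.
    by move=> x xST; split=> y Sy; apply: xST; [left|right].
  apply: contrapT => /forallNP Sx; apply: nfin; exists S => // x.
  apply: contrapT => Nx; apply: (Sx x) => y Sy.
  by rewrite leNgt; apply/negP => yx; apply: Nx; exists y.
have [p [_ clp]] := cY _ FF filterT.
have [|x [px]] := clp (far [set p]) (ball p e) _ (nbhsx_ballx p e e0).
  by exists [set p] => //; exact: finite_set1.
by rewrite ballEmdist /= ltNge px.
Qed.

End Injective.

(** * The intrinsic metric and images of compact geodesic spaces *)

Section Intrinsic.
Context {R : realType}.
Implicit Types X Y : metricType R.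

Let inf_paths_ge0 X (x y : X) :
  (0 <= ereal_inf [set Lip f | f in joins x y])%E.
Proof. by apply: le_ereal_inf_tmp => _ [f _ <-]; exact: Lip_ge0. Qed.

Lemma intrinsic_dist_le X (x y : X) (L : R) (f : @unit_interval R -> X) :
  joins x y f -> klipschitz_map L f -> intrinsic_dist x y <= L.
Proof.
move=> jf fL; rewrite /intrinsic_dist.
have := inf_paths_ge0 x y.
have : (ereal_inf [set Lip f | f in joins x y] <= L%:E)%E.
  by apply: le_trans fL; apply: ereal_inf_lbound; exists f.
by case: ereal_inf.
Qed.

(** Lipschitz connectedness keeps the infimum below +oo, so [fine] does not collapse it to 0 and
    some path comes close to attaining it. *)
Lemma intrinsic_dist_lt X (x y : X) (r : R) : lipschitz_connected X ->
  intrinsic_dist x y < r -> exists2 f, joins x y f & klipschitz_map r f.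
Proof.
move=> lcX; rewrite /intrinsic_dist => xyr.
have [f jf fL] := lcX x y.
have : (ereal_inf [set Lip f | f in joins x y] < r%:E)%E.
  have := inf_paths_ge0 x y.
  have : (ereal_inf [set Lip f | f in joins x y] < +oo)%E.
    by apply: le_lt_trans fL; apply: ereal_inf_lbound; exists f.
  by case: ereal_inf xyr.
by move=> /ereal_inf_lt [_ [g jg <-] /ltW gr]; exists g.
Qed.

Lemma Rtree_geodesic X : Rtree X -> geodesic X.
Proof.
case=> + _ => /(_ _ _)isoX x y; have [f fsurj fiso] := isoX x y.
set D := mdist x y in f fsurj fiso.
have D0 : 0 <= D by exact: mdist_ge0.
have xS : x \in segment x y by rewrite inE /segment /= mdistxx add0r.
have yS : y \in segment x y by rewrite inE /segment /= mdistxx addr0.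
pose a := exist (fun z => z \in segment x y) x xS.
pose b := exist (fun z => z \in segment x y) y yS.
have fitv u : 0 <= \val (f u) <= D.
  have := valP (f u); rewrite inE /line_segment /=.
  by rewrite in_itv.
(* The isometry onto [0, D] sends the endpoints either to (0, D) or to (D, 0). *)
pose c t := \val (f a) + t * (\val (f b) - \val (f a)).
have c_dist s t : `|c t - c s| = D * `|t - s|.
  have abD : `|\val (f b) - \val (f a)| = D by exact: (fiso a b).
  rewrite -abD mulrC -normrM; congr `|_|; rewrite /c; ring.
have cP (t : @unit_interval R) : c (\val t) \in line_segment 0 D.
  have : 0 <= \val t <= 1.
    by have := valP t; rewrite inE /unit_interval /line_segment /= in_itv.
  rewrite inE /line_segment /= in_itv /= /c => /andP[t0 t1].
  have := fitv a; have := fitv b; move: (\val (f a)) (\val (f b)) => u v.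
  by move=> /andP[v0 vD] /andP[u0 uD]; apply/andP; split; nra.
have gP (t : @unit_interval R) : exists u, f u = exist _ (c (\val t)) (cP t).
  by have [u _ fu] := fsurj (exist _ (c (\val t)) (cP t)) I; exists u.
have [g fg] := choice gP.
have f_inj u v : \val (f u) = \val (f v) -> u = v.
  by move=> /val_inj fuv; apply: mdist_positivity; rewrite -fiso fuv mdistxx.
exists (fun t => \val (g t)).
  split.
  - suff -> : g (exist _ 0 unit_interval0) = a by [].
    by apply: f_inj; rewrite fg /= /c mul0r addr0.
  - suff -> : g (exist _ 1 unit_interval1) = b by [].
    by apply: f_inj; rewrite fg /= /c mul1r addrC subrK.
apply/klipschitzP => // s t.
by rewrite -[leLHS]/(mdist (g s) (g t)) -fiso !fg -[leLHS]/(`|c _ - c _|) c_dist.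
Qed.

Lemma geodesic_lipschitz_image Y X :
  compact [set: Y] -> geodesic Y -> lipschitz_image Y X ->
  [/\ compact [set: X], lipschitz_connected X &
    totally_bounded_dist (@intrinsic_dist R X)].
Proof.
move=> cY gY [f fsurj /lipschitz_mapP[L L0 fL]].
have XE : [set: X] = f @` [set: Y].
  by apply/seteqP; split=> // x _; exact: fsurj.
have path (u v : Y) : exists2 p, joins (f u) (f v) p &
    klipschitz_map (L * mdist u v) p.
  have [p [p0 p1] pL] := gY u v.
  exists (f \o p); first by split; rewrite /= ?p0 ?p1.
  exact: klipschitz_comp (mdist_ge0 _ _) L0 pL fL.
split.
- rewrite XE; apply: continuous_compact cY.
  by apply: continuous_subspaceT; exact: klipschitz_continuous fL.
- move=> x y; have [u _ <-] := fsurj x I; have [v _ <-] := fsurj y I.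
  have [p jp pL] := path u v; exists p => //; apply/lipschitz_mapP.
  by exists (L * mdist u v) => //; rewrite mulr_ge0 ?mdist_ge0.
(* [L + 1] keeps the divisor positive when L = 0. *)
- move=> e e0; have L1 : 0 < L + 1 by rewrite ltr_wpDl.
  have [S Sfin Scov] := compact_totally_bounded cY (divr_gt0 e0 L1).
  exists (f @` S); first exact: finite_image.
  move=> x; have [u _ <-] := fsurj x I; have [v Sv vu] := Scov u.
  exists (f v); first by exists v.
  have [p jp pL] := path v u.
  apply: le_lt_trans (intrinsic_dist_le jp pL) _.
  move: vu; rewrite ltr_pdivlMr//; apply: le_lt_trans.
  by rewrite mulrC ler_wpM2l ?mdist_ge0// lerDl.
Qed.

End Intrinsic.

(** * The branching tree and its metric *)

Section Tree.
Context {R : realType}.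

Lemma half_exp_lt (e : R) : 0 < e -> exists n, 2^-1 ^+ n < e.
Proof.
move=> e0; exists (Num.bound e^-1); rewrite exprVn invf_plt ?posrE ?exprn_gt0//.
have := archi_boundP (ltW (_ : 0 < e^-1)); rewrite invr_gt0 => /(_ e0).
by move/lt_le_trans; apply; rewrite -natrX ler_nat ltnW// ltn_expl.
Qed.

(** This is 2^-1 + ... + 2^-n, the total length of the first n edges of a branch. All levels stay
    below 1, so the points of height 1 are the ends of infinite branches. *)
Definition level (n : nat) : R := 1 - 2^-1 ^+ n.

Lemma level0 : level 0 = 0.
Proof. by rewrite /level expr0 subrr. Qed.

Lemma level_nondecreasing m n : (m <= n)%N -> level m <= level n.
Proof. by move=> mn; rewrite /level lerD2l lerN2 ler_wiXn2l//; lra. Qed.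

Lemma level_ge0 n : 0 <= level n.
Proof. by rewrite -level0 level_nondecreasing. Qed.

Lemma level_lt1 n : level n < 1.
Proof. by rewrite /level ltrBlDr ltrDl exprn_gt0. Qed.

Lemma levelS n : level n.+1 - level n = 2^-1 ^+ n.+1.
Proof. by rewrite /level exprS; lra. Qed.

Variable k : nat -> nat.

(* A point of the tree is a height together with the choices made, at each
   branching level below that height, on the way up from the root. The choices
   above the height are fixed to 0 so that no quotient is needed. *)
Record tree := Tree {
  height : R ;
  choices : nat -> nat ;
  height_itv : 0 <= height <= 1 ;
  choices_le : forall n, (choices n <= k n)%N ;
  choices_above : forall n, height <= level n -> choices n = 0%N }.

HB.instance Definition _ := gen_eqMixin tree.
HB.instance Definition _ := gen_choiceMixin tree.

Implicit Types x y z w : tree.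

Lemma height_ge0 x : 0 <= height x. Proof. by case/andP: (height_itv x). Qed.
Lemma height_le1 x : height x <= 1. Proof. by case/andP: (height_itv x). Qed.

Lemma tree_eq x y : height x = height y ->
  (forall n, level n < height x -> choices x n = choices y n) -> x = y.
Proof.
move=> hxy cxy; have {cxy} : choices x = choices y.
  apply/funext => n; have [xn|nx] := ltP (level n) (height x); first exact: cxy.
  by rewrite !choices_above// -hxy.
case: x y hxy => [s b p q r] [t c p' q' r'] /= st bc.
subst t c; congr Tree; exact: Prop_irrelevance.
Qed.

Fact trunc_le (b : nat -> nat) (t : R) n :
  ((if (level n < t)%R then minn (b n) (k n) else 0) <= k n)%N.
Proof. by case: ifP => // _; exact: geq_minr. Qed.

Fact trunc_above (b : nat -> nat) (t : R) n :
  t <= level n -> (if level n < t then minn (b n) (k n) else 0%N)%R = 0%N.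
Proof. by rewrite leNgt => /negbTE ->. Qed.

(** Capping by [k n] makes any sequence admissible, so no bound on [b] has to be carried along. *)
Definition trunc (b : nat -> nat) (t : R) (t01 : 0 <= t <= 1) : tree :=
  Tree t01 (trunc_le b t) (@trunc_above b t).

Definition common x y (s : R) : Prop :=
  [/\ s <= height x, s <= height y &
     forall n, level n < s -> choices x n = choices y n].

(** The Gromov product of x and y at the root: the height at which their branches separate. *)
Definition meet x y : R := sup [set s | common x y s].

(** The supremum is attained because choices are compared only at levels strictly below s. *)
Lemma meetP x y s : s <= meet x y <-> common x y s.
Proof.
have c0 : common x y 0.
  by split; rewrite ?height_ge0// => n; rewrite ltNge level_ge0.
have cS : has_sup [set s | common x y s].
  by split; [exists 0|exists (height x) => r []].
split=> [sm|cs]; last exact: (ub_le_sup cS.2).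
have mle u : (forall r, common x y r -> r <= u) -> meet x y <= u.
  by move=> ru; apply: ge_sup => //; exists 0.
split.
- by apply: (le_trans sm); apply: mle => r [].
- by apply: (le_trans sm); apply: mle => r [].
- move=> n ns; have [r [_ _ cr] nr] := sup_gt cS.1 (lt_le_trans ns sm).
  exact: cr.
Qed.

Lemma common_meet x y : common x y (meet x y).
Proof. exact/meetP. Qed.

Lemma meet_lel x y : meet x y <= height x.
Proof. by case: (common_meet x y). Qed.

Lemma meet_ler x y : meet x y <= height y.
Proof. by case: (common_meet x y). Qed.

Lemma meet_choices x y n : level n < meet x y -> choices x n = choices y n.
Proof. by case: (common_meet x y) => _ _; apply. Qed.

Lemma meetxx x : meet x x = height x.
Proof. by apply/eqP; rewrite eq_le meet_lel; apply/meetP. Qed.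

Lemma meetC x y : meet x y = meet y x.
Proof.
wlog suff le_xy : x y / meet x y <= meet y x.
  by apply/eqP; rewrite eq_le !le_xy.
apply/meetP; split=> [||n /meet_choices//]; [exact: meet_ler|exact: meet_lel].
Qed.

(** This ultrametric inequality is the source of both the triangle inequality and the four-point
    condition. *)
Lemma meet_min x y z : Num.min (meet x y) (meet y z) <= meet x z.
Proof.
apply/meetP; split=> [||n].
- by rewrite ge_min meet_lel.
- by rewrite ge_min meet_ler orbT.
- by rewrite lt_min => /andP[/meet_choices-> /meet_choices].
Qed.

Lemma meet_min_cases x y z : meet x y <= meet x z \/ meet y z <= meet x z.
Proof. by have := meet_min x y z; rewrite ge_min => /orP. Qed.

Let dist x y : R := height x + height y - 2 * meet x y.

Let distxx x : dist x x = 0.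
Proof. rewrite /dist meetxx; ring. Qed.

Let dist_positivity x y : dist x y = 0 -> x = y.
Proof.
rewrite /dist => d0; have mx := meet_lel x y; have my := meet_ler x y.
apply: tree_eq => [|n nx]; first lra.
by apply: (@meet_choices x y); apply: (lt_le_trans nx); lra.
Qed.

Let dist_sym x y : dist x y = dist y x.
Proof. by rewrite /dist meetC (addrC (height x)). Qed.

Let dist_triangle y x z : dist x z <= dist x y + dist y z.
Proof.
rewrite /dist; have := meet_ler x y; have := meet_lel y z.
by case: (meet_min_cases x y z); lra.
Qed.

HB.instance Definition _ := @isMetric.Build R tree
  dist distxx dist_positivity dist_sym dist_triangle.

Lemma tree_distE x y : mdist x y = height x + height y - 2 * meet x y.
Proof. by []. Qed.

Lemma tree_dist_common x y (s : R) : common x y s ->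
  mdist x y <= height x + height y - 2 * s.
Proof. by move=> /meetP; rewrite tree_distE; lra. Qed.

(** The heights cancel, leaving a comparison of [meet x y + meet z w] with the two other pairings,
    which four ultrametric inequalities decide. *)
Lemma tree_four_point x y z w :
  mdist x y + mdist z w <= mdist x z + mdist y w \/
  mdist x y + mdist z w <= mdist x w + mdist y z.
Proof.
have := meet_min_cases x z y; have := meet_min_cases x w y.
have := meet_min_cases z x w; have := meet_min_cases z y w.
rewrite !tree_distE (meetC z x) (meetC z y) (meetC w y).
lra.
Qed.

End Tree.

(** * Geodesic spaces with the four-point condition are R-trees *)

Section FourPoint.
Context {R : realType} (X : metricType R).

Lemma geodesic_point (x y : X) (s : R) : geodesic X -> 0 <= s <= mdist x y ->
  exists2 z, mdist x z = s & mdist z y = mdist x y - s.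
Proof.
move=> gX; set D := mdist x y => /andP[s0 sD].
have [D0|D0] := eqVneq D 0.
  by exists x; rewrite ?mdistxx -/D; lra.
have Dgt0 : 0 < D by rewrite lt_neqAle eq_sym D0 mdist_ge0.
have [p [p0 p1] /klipschitzP-/(_ (ltW Dgt0)) pD] := gX x y.
have tP : s / D \in @unit_interval R.
  rewrite inE /unit_interval /line_segment /= in_itv /= divr_ge0 ?(ltW Dgt0)//.
  by rewrite ler_pdivrMr// mul1r.
pose t : @unit_interval R := exist _ (s / D) tP.
have DsD : D * (s / D) = s by rewrite mulrC divfK.
have d0 : mdist x (p t) <= s.
  rewrite -p0 (le_trans (pD _ _))//.
  by rewrite -[X in _ * X]/(`|s / D - 0|) subr0 ger0_norm ?DsD// divr_ge0// ltW.
have d1 : mdist (p t) y <= D - s.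
  rewrite -p1 (le_trans (pD _ _))//.
  rewrite -[X in _ * X]/(`|1 - s / D|) ger0_norm ?mulrBr ?mulr1 ?DsD//.
  by rewrite subr_ge0 ler_pdivrMr// mul1r.
have := metric_triangle x (p t) y; rewrite -/D.
by exists (p t); lra.
Qed.

(** The distance to x is an isometry on [x, y], by the four-point condition applied to x, y and two
    points of the segment. *)
Lemma four_point_Rtree : geodesic X ->
  (forall x y z w : X,
    mdist x y + mdist z w <= mdist x z + mdist y w \/
    mdist x y + mdist z w <= mdist x w + mdist y z) ->
  Rtree X.
Proof.
move=> gX fp; split=> x y.
  have segP (u : segment x y) : mdist x y = mdist x (\val u) + mdist (\val u) y.
    by have := valP u; rewrite inE.
  have ditv (u : segment x y) :
      (mdist x (\val u) : R^o) \in line_segment 0 (mdist x y).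
    rewrite inE /line_segment /= in_itv /= mdist_ge0 /= [leRHS](segP u).
    by rewrite lerDl mdist_ge0.
  exists (fun u => exist (fun s => s \in line_segment 0 (mdist x y)) _ (ditv u)).
    move=> [s sP] _; have : 0 <= s <= mdist x y.
      by move: sP; rewrite inE /line_segment /= in_itv.
    move=> /(geodesic_point gX)[z xz zy].
    have zS : z \in segment x y by rewrite inE /segment /= xz zy addrC subrK.
    by exists (exist _ z zS) => //; exact: val_inj.
  move=> u v; rewrite -[LHS]/(`|mdist x (\val v) - mdist x (\val u)|).
  rewrite -[RHS]/(mdist (\val u) (\val v)).
  move: (segP u) (segP v); move: (\val u) (\val v) => {}u {}v xuy xvy.
  have := metric_triangle x u v; have := metric_triangle x v u.
  rewrite (metric_sym v u) => uv vu.
  apply/eqP; rewrite eq_le; apply/andP; split.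
    by rewrite ler_norml; apply/andP; split; lra.
  rewrite ler_normr; apply/orP.
  by case: (fp x y u v); rewrite (metric_sym y) => ?; [right|left]; lra.
(* [g] is the Gromov product of x and z at y. By the four-point condition, the point w of [y, x] at
   distance [g] from y also lies on [y, z]; hence w = y and g = 0. *)
move=> z xyz; pose g := (mdist y x + mdist y z - mdist x z) / 2.
have t1 := metric_triangle x y z; have t2 := metric_triangle y x z.
have t3 := metric_triangle x z y; rewrite (metric_sym z y) in t3.
rewrite (metric_sym x y) in t1 t3 *.
have [|w yw wx] := @geodesic_point y x g gX.
  by apply/andP; split; rewrite /g; lra.
have wz : mdist w z <= mdist y z - g.
  by have := fp y x w z; rewrite yw (metric_sym x w) wx /g; lra.
have t4 := metric_triangle y w z.
have : (segment x y `&` segment y z) w.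
  split; rewrite /segment /=; last lra.
  by rewrite (metric_sym x y) (metric_sym x w) (metric_sym w y); lra.
by rewrite xyz => wy; move: yw; rewrite wy mdistxx /g; lra.
Qed.

End FourPoint.

(** * Injectivity and total boundedness of the tree *)

Section TreeProperties.
Context {R : realType} (k : nat -> nat).
Notation tree := (@tree R k).

Lemma tree_dist_ge_height (x y : tree) : height x - height y <= mdist x y.
Proof. by rewrite tree_distE; have := meet_ler x y; lra. Qed.

(* The ball of radius [mdist a b] around [f b] misses the root when
   [reach a b > 0], and [reach a b] is then the height of its lowest point. The
   extension sends [a] to the highest of these lowest points, which lie on a
   common branch because the balls pairwise intersect. *)
Lemma tree_injective : injective_space tree.
Proof.
move=> A B f /klipschitzP-/(_ ler01) f1.
have {}f1 b b' : mdist (f b) (f b') <= mdist (\val b) (\val b').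
  by rewrite (le_trans (f1 _ _))// mul1r.
pose reach (a : A) (b : B) := height (f b) - mdist a (\val b).
have reach_meet a a' b b' :
    reach a b + reach a' b' <= 2 * meet (f b) (f b') + mdist a a'.
  have := f1 b b'; rewrite tree_distE /reach.
  have := metric_triangle (\val b) a (\val b').
  have := metric_triangle a a' (\val b').
  rewrite (metric_sym (\val b) a); lra.
have reach_lip a a' b : reach a b <= reach a' b + mdist a a'.
  rewrite /reach; have := metric_triangle a' a (\val b).
  rewrite (metric_sym a' a); lra.
(* The element 0 stands for the root, the value at [a] when no reach is positive. *)
pose S a := [set r | r = 0 \/ exists b, r = reach a b].
have S0 a : S a !=set0 by exists 0; left.
have S1 a : ubound (S a) 1.
  move=> r [->//|[b ->]].
  by rewrite /reach; have := height_le1 (f b); have := mdist_ge0 a (\val b); lra.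
have hS a : has_sup (S a) by split=> //; exists 1; exact: S1.
pose h a := sup (S a).
have h_ge a b : reach a b <= h a by apply: (ub_le_sup (hS a).2); right; exists b.
have h_itv a : 0 <= h a <= 1.
  by rewrite (ub_le_sup (hS a).2) /=; [exact: ge_sup|left].
have h_le a u : 0 <= u -> (forall b, reach a b <= u) -> h a <= u.
  by move=> u0 ru; apply: ge_sup => // r [->|[b ->]].
have h_lt a u : 0 <= u -> u < h a -> exists b, u < reach a b.
  move=> u0 /(sup_gt (S0 a))[r [->|[b ->]] ur]; last by exists b.
  by move: ur; rewrite ltNge u0.
(* By [reach_meet] with a' = a, all [f b] whose reach exceeds [level n] make the same choice there;
   these choices form the branch of [z]. *)
have gP a : exists z : tree, height z = h a /\ forall b, reach a b <= meet z (f b).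
  have cP n : exists c, (c <= k n)%N /\
      forall b, level n < reach a b -> choices (f b) n = c.
    have [[b nb]|nb] := pselect (exists b, level n < reach a b).
      exists (choices (f b) n); split=> [|b' nb']; first exact: choices_le.
      apply: meet_choices; have := reach_meet a a b' b; rewrite mdistxx; lra.
    by exists 0%N; split=> // b bn; case: nb; exists b.
  have [c cc] := choice cP.
  exists (trunc k c (h_itv a)); split=> // b; apply/meetP; split=> //=.
    by rewrite /reach gerBl mdist_ge0.
  move=> n nb; rewrite (lt_le_trans nb (h_ge a b)) ((cc n).2 b nb).
  by apply/minn_idPl; exact: (cc n).1.
have [g /all_and2[gh gm]] := choice gP.
have hh_lip a a' : h a <= h a' + mdist a a'.
  apply: h_le => [|b].
    by rewrite addr_ge0 ?mdist_ge0//; case/andP: (h_itv a').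
  by rewrite (le_trans (reach_lip a a' b))// lerD2r.
exists g => [|b].
  apply/klipschitzP => // a a'; rewrite mul1r tree_distE !gh.
  set m := meet (g a) (g a').
  have m0 : 0 <= m by apply/meetP; split; rewrite ?height_ge0// => n; rewrite ltNge level_ge0.
  have [ham|mha] := leP (h a) m.
    by have := hh_lip a' a; rewrite (metric_sym a'); lra.
  have [ha'm|mha'] := leP (h a') m.
    by have := hh_lip a a'; lra.
  (* Both heights now exceed m. Choose b and b' whose reaches exceed m and almost attain the
     heights: then [f b] and [f b'] separate at height at most m, and [reach_meet] bounds the
     heights. *)
  apply/ler_addgt0Pr => e e0.
  have [||b] := @h_lt a (Num.max m (h a - e / 2)).
  - by rewrite le_max m0.
  - by rewrite gt_max mha; lra.
  rewrite gt_max => /andP[mb hb].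
  have [||b'] := @h_lt a' (Num.max m (h a' - e / 2)).
  - by rewrite le_max m0.
  - by rewrite gt_max mha'; lra.
  rewrite gt_max => /andP[mb' hb'].
  have := reach_meet a a' b b'.
  have := gm a b; have := gm a' b'.
  have := meet_min_cases (g a) (f b) (g a').
  have := meet_min_cases (f b) (f b') (g a').
  rewrite -/m (meetC (f b') (g a')); lra.
have hb : h (\val b) = height (f b).
  apply/eqP; rewrite eq_le; apply/andP; split.
    apply: h_le => [|b']; first exact: height_ge0.
    have := tree_dist_ge_height (f b') (f b); have := f1 b' b.
    by rewrite (metric_sym (\val b')) /reach; lra.
  by rewrite (le_trans _ (h_ge _ b))// /reach mdistxx subr0.
apply: mdist_positivity; apply/eqP; rewrite eq_le mdist_ge0 andbT tree_distE gh hb.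
by have := gm (\val b) b; rewrite /reach mdistxx; lra.
Qed.

Lemma tree_Rtree : Rtree tree.
Proof.
apply: four_point_Rtree; last exact: tree_four_point.
exact/injective_geodesic/tree_injective.
Qed.

(** The net rounds heights down to multiples of 2^-n and keeps only the choices below [level n].
    What lies above that level is at most 2^-n high, so the error is below 2 * 2^-n < e. *)
Lemma tree_totally_bounded : totally_bounded tree.
Proof.
move=> e e0; have [n ne] := half_exp_lt (divr_gt0 e0 (ltr0Sn R 1)).
pose N := (2 ^ n)%N; pose K := (\max_(i < n) k i)%N.
have NE : N%:R^-1 = 2^-1 ^+ n :> R by rewrite /N natrX exprVn.
have N0 : 0 < N%:R :> R by rewrite ltr0n expn_gt0.
have jP (j : 'I_N.+1) : 0 <= (j%:R / N%:R : R) <= 1.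
  apply/andP; split; first by rewrite divr_ge0 ?ler0n.
  by rewrite ler_pdivrMr// mul1r ler_nat -ltnS.
pose b (w : {ffun 'I_n -> 'I_K.+1}) i := if insub i is Some i' then w i' : nat else 0%N.
pose F (p : {ffun 'I_n -> 'I_K.+1} * 'I_N.+1) := trunc k (b p.1) (jP p.2).
exists (range F); first by apply: finite_image; exact: finite_finset.
move=> x; have hx0 := height_ge0 x; have hx1 := height_le1 x.
pose j := Num.truncn (height x * N%:R).
have /andP[jx xj] : j%:R <= height x * N%:R < j.+1%:R.
  by rewrite /j; apply: truncn_itv; rewrite mulr_ge0// ltW.
have jN : (j < N.+1)%N.
  by rewrite ltnS -(ler_nat R) (le_trans jx)// ler_piMl// ltW.
pose w : {ffun 'I_n -> 'I_K.+1} := [ffun i : 'I_n => inord (choices x i)].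
exists (F (w, Ordinal jN)); first by exists (w, Ordinal jN).
set y := F _; have hy : height y = j%:R / N%:R by [].
have yx : height y <= height x by rewrite hy ler_pdivrMr.
have xy : height x < height y + 2^-1 ^+ n.
  by rewrite hy -NE -[X in _ + X]mul1r -mulrDl natr1 ltr_pdivlMr.
have : common y x (Num.min (height y) (level n)).
  split=> [||i]; rewrite ?ge_min ?lexx ?yx//.
  rewrite lt_min => /andP[iy il].
  have lin : (i < n)%N.
    by rewrite ltnNge; apply/negP => /(@level_nondecreasing R); rewrite leNgt il.
  rewrite /= -[X in level i < X]hy iy /b insubT /w ffunE inordK.
    by apply/minn_idPl; exact: choices_le.
  rewrite ltnS (leq_trans (choices_le x i))//.
  exact: (leq_bigmax (Ordinal lin)).
move=> /tree_dist_common /le_lt_trans; apply.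
by have := ne; rewrite /level; case: (leP (height y) (1 - 2^-1 ^+ n)); lra.
Qed.

End TreeProperties.

(** * Pointwise ultralimits of Lipschitz maps *)

Section UltraLimit.
Context {R : realType} (T X : metricType R).

(** Along an ultrafilter finer than [\oo], compactness provides all pointwise limits at once, and
    the Lipschitz inequality passes to them. *)
Lemma klipschitz_ultralimit (L : R) (Phi : nat -> T -> X) :
  compact [set: X] -> 0 <= L -> (forall n, klipschitz_map L (Phi n)) ->
  exists2 g : T -> X, klipschitz_map L g &
    forall z c, (\forall n \near \oo, Phi n z = c) -> g z = c.
Proof.
move=> cX L0 PhiL; have [U [UU ooU]] := @ultraFilterLemma _ (\oo : set_system nat) _.
have UF := @ultra_proper _ _ UU.
have limP z : exists p, forall e, 0 < e -> U [set n | mdist p (Phi n z) < e].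
  have [p [_ clp]] := cX (Phi ^~ z @ U) _ filterT.
  exists p => e e0.
  have [//|far] := in_ultra_setVsetC [set n | mdist p (Phi n z) < e] UU.
  have [x [/= px]] := clp [set x | ~ mdist p x < e] (ball p e) far (nbhsx_ballx p e e0).
  by rewrite ballEmdist.
have [g gP] := choice limP; exists g.
  apply/klipschitzP => // z w; apply/ler_addgt0Pr => e e0.
  have e2 : 0 < e / 2 by rewrite divr_gt0.
  have [n [/= gz gw]] := filter_ex (filterI (gP z _ e2) (gP w _ e2)).
  have /klipschitzP-/(_ L0)/(_ z w) := PhiL n.
  have := metric_triangle (g z) (Phi n z) (g w).
  have := metric_triangle (Phi n z) (Phi n w) (g w).
  rewrite (metric_sym (Phi n w)); lra.
move=> z c /ooU cz; apply: mdist_positivity; apply/eqP; rewrite eq_le mdist_ge0 andbT.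
apply/ler_addgt0Pr => e e0; rewrite add0r.
by have [n [/= /ltW + <-]] := filter_ex (filterI (gP z _ e0) cz).
Qed.

End UltraLimit.

(** * Concatenating edges into a map on the tree *)

Section Walk.
Context {R : realType} (X : metricType R) (k : nat -> nat) (L : R).
Variables (x0 : X) (E : nat -> X -> nat -> R -> X).
Hypothesis L0 : 0 <= L.
Hypothesis E_start : forall n x i, E n x i (level n) = x.
Hypothesis E_lip : forall n x i s t,
  mdist (E n x i s) (E n x i t) <= L * `|t - s|.

(* [E m x i] is the [i]-th edge from level [m] to level [m + 1] starting at [x]. *)
Fixpoint walk (b : nat -> nat) (n : nat) (t : R) : X :=
  if n isn't m.+1 then x0
  else if t <= level m then walk b m t else E m (walk b m (level m)) (b m) t.

Lemma walkS b n : walk b n.+1 (level n.+1) = E n (walk b n (level n)) (b n) (level n.+1).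
Proof.
by rewrite /= leNgt -subr_gt0 levelS exprn_gt0//= invr_gt0.
Qed.

(** By [E_start], consecutive pieces agree at [level n], and the triangle inequality through that
    point glues the bounds. *)
Lemma walk_lip b n s t : mdist (walk b n s) (walk b n t) <= L * `|t - s|.
Proof.
elim: n s t => [|n IHn] s t; first by rewrite mdistxx mulr_ge0.
wlog st : s t / s <= t => [H|].
  by have [/H//|/ltW/H] := leP s t; rewrite metric_sym distrC.
rewrite /=; have [tn|nt] := leP t (level n); first by rewrite (le_trans st tn).
have [sn|//] := leP s (level n).
have := IHn s (level n).
have := E_lip n (walk b n (level n)) (b n) (level n) t; rewrite E_start.
have := metric_triangle (walk b n s) (walk b n (level n))
  (E n (walk b n (level n)) (b n) t).
rewrite !ger0_norm ?subr_ge0//; last exact: ltW.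
by rewrite -(subrKA (level n) t) mulrDr (addrC (L * _)); lra.
Qed.

Lemma walk_eq b b' n s : (forall i, level i < s -> b i = b' i) ->
  walk b n s = walk b' n s.
Proof.
elim: n s => //= n IHn s bb'; have [sn|ns] := leP s (level n); first exact: IHn.
by rewrite (IHn (level n)) ?bb'// => i /lt_trans/(_ ns)/bb'.
Qed.

Lemma walk_stable b m n : (n <= m)%N -> walk b m (level n) = walk b n (level n).
Proof.
elim: m => [|m IHm]; first by rewrite leqn0 => /eqP ->.
rewrite leq_eqVlt => /predU1P[->//|nm] /=.
by rewrite level_nondecreasing// IHm.
Qed.

(** The walks to z and w agree up to [meet z w], and the two remaining legs have total length the
    tree distance. At a vertex the walks stabilize, so the ultralimit keeps their value; it is what
    defines the map at height 1. *)
Lemma walk_tree_map : compact [set: X] ->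
  exists2 g : @tree R k -> X, klipschitz_map L g &
    forall b n, (forall i, (b i <= k i)%N) -> exists z, g z = walk b n (level n).
Proof.
move=> cX; pose Phi n (z : @tree R k) := walk (choices z) n (height z).
have [|g gL gP] := klipschitz_ultralimit cX L0 (_ : forall n, klipschitz_map L (Phi n)).
  move=> n; apply/klipschitzP => // z w.
  have zw : walk (choices z) n (meet z w) = walk (choices w) n (meet z w).
    by apply: walk_eq => i; exact: meet_choices.
  have := metric_triangle (Phi n z) (walk (choices z) n (meet z w)) (Phi n w).
  move=> /le_trans; apply.
  have := walk_lip (choices z) n (meet z w) (height z).
  have := walk_lip (choices w) n (meet z w) (height w).
  rewrite !ger0_norm ?subr_ge0 ?meet_lel ?meet_ler// tree_distE {1}metric_sym -zw.
  by rewrite /Phi; lra.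
exists g => // b n bk.
have n01 : 0 <= (level n : R) <= 1 by rewrite level_ge0 ltW// level_lt1.
exists (trunc k b n01); apply: gP; exists n => // m /= nm.
rewrite -(walk_stable b nm); apply: walk_eq => i /= il.
by rewrite il; exact/minn_idPl.
Qed.

End Walk.

(** * From a totally bounded intrinsic metric to a map of a tree onto the space *)

Section FromIntrinsic.
Context {R : realType} (X : metricType R).

(** Clamping the parameter makes the path constant outside [a, b], hence defined on the whole line
    as the edges of a walk must be. *)
Lemma path_reparam (x y : X) (K a b : R) f : a < b -> 0 <= K ->
  joins x y f -> klipschitz_map K f ->
  exists e : R -> X, [/\ e a = x, e b = y &
    forall s t, mdist (e s) (e t) <= K / (b - a) * `|t - s|].
Proof.
move=> ab K0 [f0 f1] /klipschitzP-/(_ K0) fK.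
pose clamp (t : R) : R := Num.max 0 (Num.min t 1).
have clampP t : clamp t \in @unit_interval R.
  rewrite inE /unit_interval /line_segment /= in_itv /= /clamp.
  by rewrite le_max lexx ge_max ler01 ge_min lexx orbT.
have clamp_lip s t : `|clamp t - clamp s| <= `|t - s|.
  wlog st : s t / s <= t => [H|].
    by have [/H//|/ltW/H] := leP s t; rewrite distrC (distrC t).
  rewrite (ger0_norm (_ : 0 <= t - s)) ?subr_ge0// /clamp ler_norml.
  apply/andP; split.
    case: (leP s 1) => s1; case: (leP t 1) => t1;
    rewrite ?(max_r ler01); try lra.
    - by case: (leP 0 s) => s0; case: (leP 0 t) => t0; lra.
    - by case: (leP 0 s) => s0; lra.
  case: (leP s 1) => s1; case: (leP t 1) => t1;
  rewrite ?(max_r ler01); try lra.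
  - by case: (leP 0 s) => s0; case: (leP 0 t) => t0; lra.
  - by case: (leP 0 s) => s0; lra.
have ba0 : 0 < b - a by rewrite subr_gt0.
pose e t := f (exist (fun u => u \in unit_interval) _ (clampP ((t - a) / (b - a)))).
have eE t (u : @unit_interval R) : clamp ((t - a) / (b - a)) = \val u -> e t = f u.
  by move=> cu; rewrite /e; congr f; exact: val_inj.
exists e; split.
- rewrite -f0; apply: eE => /=.
  by rewrite /clamp subrr mul0r (min_l ler01) maxxx.
- rewrite -f1; apply: eE => /=.
  by rewrite /clamp divff ?gt_eqF// minxx (max_r ler01).
move=> s t; rewrite (le_trans (fK _ _))// -mulrA ler_wpM2l//.
rewrite -[leLHS]/(`|clamp _ - clamp _|) (le_trans (clamp_lip _ _))//.
by rewrite -mulrBl opprB addrA subrK normrM normfV (gtr0_norm ba0) mulrC.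
Qed.

Hypotheses (cX : compact [set: X]) (lcX : lipschitz_connected X).
Hypothesis tbX : totally_bounded_dist (@intrinsic_dist R X).

Let nets (x0 : X) : exists (v : nat -> nat -> X) (k : nat -> nat),
  forall n x, exists2 i, (i <= k n)%N & intrinsic_dist (v n i) x < 2^-1 ^+ n.+1.
Proof.
have netP n : exists vk : (nat -> X) * nat, forall x,
    exists2 i, (i <= vk.2)%N & intrinsic_dist (vk.1 i) x < 2^-1 ^+ n.+1.
  have [|F /finite_seqP[s ->] Fcov] := @tbX (2^-1 ^+ n.+1).
    by rewrite exprn_gt0// invr_gt0.
  (* Index [size s] is allowed as well; there [nth] returns [x0], a harmless extra point. *)
  exists (nth x0 s, size s) => x; have [y /= ys yx] := Fcov x.
  by exists (index y s); rewrite ?index_size ?nth_index.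
have [vk vkP] := choice netP.
by exists (fun n => (vk n).1), (fun n => (vk n).2).
Qed.

Lemma tree_lipschitz_image (x0 : X) :
  exists k : nat -> nat, lipschitz_image (@tree R k) X.
Proof.
have [v [k vk]] := nets x0.
(* [C] exceeds the distance from the base point to every point of the first net; C >= 1 serves at
   the later levels. *)
pose C : R := 1 + \sum_(i < (k 0%N).+1) `|intrinsic_dist x0 (v 0%N i)|.
have C1 : 1 <= C by rewrite lerDl sumr_ge0.
have C0 : 0 < C by rewrite (lt_le_trans ltr01).
have Cv i : (i <= k 0)%N -> intrinsic_dist x0 (v 0%N i) < C.
  move=> ik; rewrite (le_lt_trans (ler_norm _))// /C (bigD1 (Ordinal (ik : i < _.+1)%N))//=.
  by rewrite addrCA ltrDl ltr_wpDr// sumr_ge0.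
have edgeP (p : nat * X * nat) : exists e : R -> X,
    [/\ e (level p.1.1) = p.1.2,
      forall s t, mdist (e s) (e t) <= 2 * C * `|t - s| &
      intrinsic_dist p.1.2 (v p.1.1 p.2) < C * 2^-1 ^+ p.1.1 ->
        e (level p.1.1.+1) = v p.1.1 p.2].
  case: p => [[n x] i] /=.
  (* A path with constant C * 2^-n on [0, 1], run along an edge of length 2^-(n+1), has constant 2 *
     C at every level. *)
  have [xv|xv] := ltP (intrinsic_dist x (v n i)) (C * 2^-1 ^+ n); last first.
    by exists (fun=> x); split=> // s t; rewrite mdistxx !mulr_ge0// ltW.
  have [f jf fK] := intrinsic_dist_lt lcX xv.
  have h0 : 0 < 2^-1 ^+ n :> R by rewrite exprn_gt0// invr_gt0.
  have [||e [e0 e1 eK]] := path_reparam (a := level n) (b := level n.+1) _ _ jf fK.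
  - by rewrite -subr_gt0 levelS exprn_gt0// invr_gt0.
  - by apply: mulr_ge0; exact: ltW.
  exists e; split=> // s t; rewrite (le_trans (eK s t))// levelS.
  suff -> : C * 2^-1 ^+ n / 2^-1 ^+ n.+1 = 2 * C by [].
  by rewrite exprS; field; rewrite gt_eqF.
have [e eP] := choice edgeP.
pose E n x i := e (n, x, i).
have E_start n x i : E n x i (level n) = x by have [] := eP (n, x, i).
have E_lip n x i s t : mdist (E n x i s) (E n x i t) <= 2 * C * `|t - s|.
  by have [_ + _] := eP (n, x, i); apply.
have E_end n x i : intrinsic_dist x (v n i) < C * 2^-1 ^+ n ->
    E n x i (level n.+1) = v n i.
  by have [_ _] := eP (n, x, i); apply.
have L0 : 0 <= 2 * C by rewrite mulr_ge0// ltW.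
have [g gL gW] := walk_tree_map k x0 L0 E_start E_lip cX.
(* To reach a point of net n+1, first reach a point of net n within 2^-(n+1) of it; the next edge
   then really leads to the target. *)
have reach n i : (i <= k n)%N -> exists2 b, forall j, (b j <= k j)%N &
    walk x0 E b n.+1 (level n.+1) = v n i.
  elim: n i => [|n IHn] i ik.
    exists (fun j => if j == 0%N then i else 0%N) => [[]//|].
    by rewrite walkS /= E_end// expr0 mulr1; exact: Cv.
  have [j jk jv] := vk n (v n.+1 i); have [b bk bv] := IHn j jk.
  exists (fun m => if m == n.+1 then i else b m) => [m|].
    by case: eqP => // ->.
  rewrite walkS eqxx (@walk_eq _ _ _ _ _ b) => [|m].
    by rewrite bv E_end// (lt_le_trans jv)// ler_peMl// exprn_ge0// invr_ge0.
  by case: eqP => // ->; rewrite ltxx.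
exists k, g; last by apply/lipschitz_mapP; exists (2 * C).
have gclosed : closed (range g).
  apply: compact_closed; first exact: metric_hausdorff.
  apply: continuous_compact.
    by apply: continuous_subspaceT; exact: klipschitz_continuous gL.
  apply: injective_totally_bounded_compact; first exact: tree_injective.
  exact: tree_totally_bounded.
move=> x _; apply: gclosed => B /nbhs_ballP[r r0 rB].
have [n nr] := half_exp_lt r0.
have [i ik ix] := vk n x; have [b bk bv] := reach n i ik.
have [z zE] := gW b n.+1 bk.
exists (v n i); split; first by exists z => //; rewrite zE bv.
apply: rB; rewrite ballEmdist /= metric_sym.
(* The ends of a path on [0, 1] are no farther apart than its Lipschitz constant, so nets for the
   intrinsic metric are dense for the original one. *)
have [f [f0 f1] fK] := intrinsic_dist_lt lcX ix.
have h0 : 0 <= 2^-1 ^+ n.+1 :> R by rewrite exprn_ge0// invr_ge0.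
have /klipschitzP-/(_ h0) fL := fK.
rewrite -{1}f0 -f1 (le_lt_trans (fL _ _))// (le_lt_trans _ nr)//.
rewrite -[X in _ * X]/(`|1 - 0|) subr0 normr1 mulr1 exprS.
by rewrite ler_piMl// ?exprn_ge0 ?invr_ge0// invf_le1// ler1n.
Qed.

End FromIntrinsic.

(** * The cycle of implications *)

Theorem theorem1p3 (R : realType) (X : metricType R) (X0 : [set: X] !=set0) :
  [<-> (exists Y : metricType R,
          [/\ totally_bounded Y, injective_space Y & lipschitz_image Y X]);
       (exists T : metricType R,
          [/\ compact [set: T], Rtree T & lipschitz_image T X]);
       [/\ compact [set: X], lipschitz_connected X &
          totally_bounded_dist (@intrinsic_dist R X)]].
Proof.
have [x0 _] := X0.
(* Separated out because (1) implies (2) by way of (3) and the tree construction. *)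
have image13 (Y : metricType R) :
    totally_bounded Y -> injective_space Y -> lipschitz_image Y X ->
    [/\ compact [set: X], lipschitz_connected X &
      totally_bounded_dist (@intrinsic_dist R X)].
  move=> tbY injY; apply: geodesic_lipschitz_image.
    exact: injective_totally_bounded_compact.
  exact: injective_geodesic.
tfae.
- move=> [Y [tbY injY YX]]; have [cX lcX tbX] := image13 Y tbY injY YX.
  have [k kX] := tree_lipschitz_image cX lcX tbX x0.
  exists (@tree R k); split=> //; last exact: tree_Rtree.
  exact: injective_totally_bounded_compact (@tree_injective R k) (@tree_totally_bounded R k).
- move=> [T [cT /Rtree_geodesic gT TX]]; exact: geodesic_lipschitz_image TX.
- move=> [cX lcX tbX]; have [k kX] := tree_lipschitz_image cX lcX tbX x0.
  exists (@tree R k); split=> //; first exact: tree_totally_bounded.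
  exact: tree_injective.
Qed.
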